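(* Let $\mu,\{p_n\},\{u_n\},\{\mathcal J_n\},\{x_n\}$ and the kernels $K$ and $k$ be as in the context. Every function $f$ of the form $$f(t)=\int u(x)K(x,t)\,d\mu(x)$$ with $u\in L^2(\mu)$ admits an expansion $$f(t)=\sum_{n=0}^{\infty}a_n\mathcal J_n(t),$$ where the coefficients $a_n$ are given by $$a_n=u_n\langle u,p_n\rangle_{L^2(\mu)},$$ and a sampling expansion $$f(t)=\sum_{n}f(x_n)\frac{k(t,x_n)}{k(x_n,x_n)}.$$ The sum in the sampling expansion converges absolutely. Furthermore, it converges uniformly in every set such that $\|K(\cdot,t)\|_{L^2(\mu)}$ is finite.
   Context: $\mu$ is a measure on the real line and $\{p_n\}_{n\ge0}$ is a complete orthonormal system in $L^2(\mu)$. $(t_j)_{j\ge0}$ is a sequence of points on the real line, and $\{r_n\}_{n\ge0}$ is a discrete orthonormal system with $$\sum_{j=0}^{\infty}\rho(t_j)r_n(t_j)\overline{r_m(t_j)}=\delta_{mn},\qquad \sum_{k=0}^{\infty}r_k(t_n)\overline{r_k(t_m)}=\frac{\delta_{mn}}{\rho(t_n)},$$ complete in the $\ell^2$ space of the discrete measure $\sum_j\rho(t_j)\delta_{t_j}$. $\{u_k\}_{k\ge0}$ is a sequence of complex numbers on the unit circle (not to be confused with the function $u$). The points $x_n$ are given by $t_n=1/x_n$. $\{\mathcal J_k\}_{k\ge0}$ is an auxiliary system of functions with $\{\mathcal J_k(t)\}_{k\ge0}\in\ell^2$ for every real $t$, interpolating the $r_k$ in the sense that $$\mathcal J_k(x_n)=\lambda_n\,r_k(1/x_n)\qquad(k,n=0,1,\dots)$$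 for some real constants $\lambda_n$ independent of $k$. The kernel $K$ is $$K(x,t)=\sum_{k=0}^{\infty}\mathcal J_k(t)\,p_k(x)\,u_k ,$$ so that $K(x,x_n)=\lambda_n\sum_k r_k(t_n)p_k(x)u_k$, and $$k(t,s)=\int K(x,t)\overline{K(x,s)}\,d\mu(x)$$ is the reproducing kernel of the range of the transform $g\mapsto\int g(x)K(x,\cdot)\,d\mu(x)$ on $L^2(\mu)$, this range carrying the inner product that makes the transform an isometry.
   Formalization: The coefficients are a_n = u_n∫u p_n dμ, equal to u_n⟨u,p_n⟩ when p_n is real a.e. (the formula fails for complex p_n); uniform convergence is on sets where ‖K(·,t)‖ is bounded (finite alone is not enough); λ_n ≠ 0 is assumed so that k(x_n,x_n) ≠ 0. *)

(* Defs.v *)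
From HB Require Import structures.
From mathcomp Require Import all_boot all_order all_algebra.
From mathcomp Require Import complex.
From mathcomp Require Import all_classical all_reals all_analysis.

Set Implicit Arguments.
Unset Strict Implicit.
Unset Printing Implicit Defensive.

Import Order.TTheory GRing.Theory Num.Theory.
Import numFieldTopology.Exports numFieldNormedType.Exports.

Local Open Scope classical_set_scope.
Local Open Scope ring_scope.
Local Open Scope complex_scope.

(* The modulus as an element of R; `|z| lives in R[i]. *)
Definition cabs {R : realType} (z : R[i]) : R := ComplexField.Normc.normc z.

(* R[i] receives its topology through the alias R[i]^o. *)
Definition has_sum {R : realType} (a : nat -> R[i]) (l : R[i]) : Prop :=
  (series a : nat -> R[i]^o) @ \oo --> (l : R[i]^o).

Definition abs_summable {R : realType} (a : nat -> R[i]) : Prop :=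
  cvgn (series (fun n => cabs (a n))).

Definition square_summable {R : realType} (a : nat -> R[i]) : Prop :=
  cvgn (series (fun n => cabs (a n) ^+ 2)).

Section ComplexL2.
Context {d : measure_display} {T : measurableType d} {R : realType}.
Variable mu : {measure set T -> \bar R}.

Definition cintegral (g : T -> R[i]) : R[i] :=
  (\int[mu]_x complex.Re (g x))%R +i* (\int[mu]_x complex.Im (g x))%R.

Definition L2norm (g : T -> R[i]) : \bar R :=
  'N[mu]_(2%:E)[(fun x => (cabs (g x))%:E)]%E.

Definition in_L2 (g : T -> R[i]) : Prop :=
  [/\ measurable_fun [set: T] (fun x => complex.Re (g x)),
      measurable_fun [set: T] (fun x => complex.Im (g x)) &
      (L2norm g < +oo)%E].

Definition inner (g h : T -> R[i]) : R[i] :=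
  cintegral (fun x => g x * (h x)^*).

Definition orthonormal_system (p : nat -> T -> R[i]) : Prop :=
  (forall n, in_L2 (p n)) /\
  (forall m n, inner (p m) (p n) = (m == n)%:R).

(* Totality: only the zero class is orthogonal to every p n. *)
Definition complete_system (p : nat -> T -> R[i]) : Prop :=
  forall g, in_L2 g -> (forall n, inner g (p n) = 0) ->
  {ae mu, forall x, g x = 0}.

(* \sum_k g k = h in L^2(mu); no pointwise convergence is asserted. *)
Definition has_L2_sum (g : nat -> T -> R[i]) (h : T -> R[i]) : Prop :=
  L2norm (fun x => h x - \sum_(0 <= k < N) g k x) @[N --> \oo] --> 0%E.

End ComplexL2.

Section DiscreteSystem.
Context {R : realType}.
Variables (t : nat -> R) (rho : R -> R) (r : nat -> R -> R[i]).

Definition discrete_orthonormal : Prop :=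
  forall m n,
    has_sum (fun j => (rho (t j))%:C * r n (t j) * (r m (t j))^*) (m == n)%:R.

Definition dual_orthogonal : Prop :=
  forall m n,
    has_sum (fun k => r k (t n) * (r k (t m))^*)
            ((m == n)%:R / (rho (t n))%:C).

(* Totality in the l^2 space of the measure \sum_j rho(t_j) \d_(t_j). *)
Definition discrete_complete : Prop :=
  forall c : R -> R[i],
    cvgn (series (fun j => rho (t j) * cabs (c (t j)) ^+ 2)) ->
    (forall n, has_sum (fun j => (rho (t j))%:C * c (t j) * (r n (t j))^*) 0) ->
    forall j, c (t j) = 0.

End DiscreteSystem.

Definition repr_kernel {d : measure_display} {X : measurableType d}
    {R : realType} {I : Type} (mu : {measure set X -> \bar R})
    (K : X -> I -> R[i]) (t s : I) : R[i] :=
  inner mu (K^~ t) (K^~ s).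

(* Main.v *)
Require Import Defs.
From HB Require Import structures.
From mathcomp Require Import all_boot all_order all_algebra.
From mathcomp Require Import complex.
From mathcomp Require Import all_classical all_reals all_analysis.
From mathcomp Require Import measurable_realfun ring lra.
Import Order.TTheory GRing.Theory Num.Theory.
Import numFieldTopology.Exports numFieldNormedType.Exports.
Local Open Scope classical_set_scope.
Local Open Scope ring_scope.
Local Open Scope complex_scope.

(* Put e_n = K(., x_n) / ||K(., x_n)||.  The dual orthogonality of the r_k makes
   (e_n) orthonormal in L^2(mu), and sum_n |<p_k, e_n>|^2 =
   sum_n rho(t_n) |r_k(t_n)|^2 = 1 puts each p_k, hence each K(., s), in the
   closed span of (e_n).  The sampling series is then the Parseval expansion of
   f(s) = <K(., s), conj u> along (e_n); by Cauchy-Schwarz its tail is at most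
   ||K(., s)|| times the square root of a Bessel tail of conj u, which does not
   depend on s.  No completeness of L^2(mu) is involved. *)

(** * Modulus on [R[i]] and convergence of complex series *)

Section ComplexModulus.
Context {R : realType}.
Implicit Types z y : R[i].

Lemma cabsE z : `|z| = (cabs z)%:C.
Proof. by []. Qed.

Lemma cabs_ge0 z : 0 <= cabs z.
Proof. by case: z => a b; exact: sqrtr_ge0. Qed.

Lemma sqr_cabs z : cabs z ^+ 2 = complex.Re z ^+ 2 + complex.Im z ^+ 2.
Proof. by case: z => a b; rewrite /cabs /= sqr_sqrtr// addr_ge0// sqr_ge0. Qed.

Lemma mulcJ z : z * z^* = (cabs z ^+ 2)%:C.
Proof. by rewrite -sqr_normc cabsE rmorphXn. Qed.

Lemma cabsM z y : cabs (z * y) = cabs z * cabs y.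
Proof. exact: ComplexField.Normc.normcM. Qed.

Lemma cabsJ z : cabs z^* = cabs z.
Proof. by case: z => a b; rewrite /cabs /= sqrrN. Qed.

Lemma ler_cabsD z y : cabs (z + y) <= cabs z + cabs y.
Proof. exact: le_normcD. Qed.

Lemma cabsR (a : R) : cabs a%:C = `|a|.
Proof. by rewrite /cabs /= expr0n /= addr0 sqrtr_sqr. Qed.

Lemma conjcR (a : R) : a%:C^*%R = a%:C :> R[i].
Proof. exact: conjc_real. Qed.

(** Passes from [R[i]^o], whose radii are complex, to real sequences, where squeezing and square
    roots are available. *)
Lemma cvg_cabsP (v : nat -> R[i]) (l : R[i]) :
  (v : nat -> R[i]^o) @ \oo --> (l : R[i]^o) <->
  cabs (l - v n) @[n --> \oo] --> (0 : R).
Proof.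
split.
- move/cvgrPdist_lt => h; apply/cvgrPdist_lt => e e0.
  have e0' : 0 < e%:C by rewrite ltcR.
  have := h _ e0'; apply: filterS => n /=.
  rewrite [X in X < _]cabsE ltcR.
  by rewrite sub0r normrN ger0_norm// cabs_ge0.
- move/cvgrPdist_lt => h; apply/cvgrPdist_lt => e.
  (* Positivity in the order of [R[i]] forces the imaginary part of the radius to vanish. *)
  case: e => e e'; rewrite ltcE /= => /andP[/eqP -> e0].
  have := h _ e0; apply: filterS => n /=.
  rewrite [X in _ -> X < _]cabsE.
  by rewrite sub0r normrN ger0_norm ?cabs_ge0// ltcR.
Qed.

Lemma has_sumP (a : nat -> R[i]) (l : R[i]) :
  has_sum a l <->
  cabs (l - \sum_(0 <= k < n) a k) @[n --> \oo] --> (0 : R).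
Proof. exact: (cvg_cabsP (series a)). Qed.

Lemma has_sum_unique (a : nat -> R[i]) (l l' : R[i]) :
  has_sum a l -> has_sum a l' -> l = l'.
Proof. by move=> h h'; exact: (cvg_unique _ h h'). Qed.

Lemma has_sumZ (c : R[i]) (a : nat -> R[i]) (l : R[i]) :
  has_sum a l -> has_sum (fun n => c * a n) (c * l).
Proof.
move=> /has_sumP h; apply/has_sumP.
under eq_fun do rewrite -mulr_sumr -mulrBr cabsM.
by rewrite -(mulr0 (cabs c)); exact: cvgMr.
Qed.

Lemma has_sum_real (a : nat -> R) (l : R) :
  has_sum (fun n => (a n)%:C) l%:C <->
  \sum_(0 <= k < n) a k @[n --> \oo] --> l.
Proof.
have E n : cabs (l%:C - \sum_(0 <= k < n) (a k)%:C) = `|l - \sum_(0 <= k < n) a k|.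
  by rewrite -rmorph_sum -rmorphB cabsR.
split.
- move=> /has_sumP/cvgrPdist_lt h; apply/cvgrPdist_lt => d /h.
  by apply: filterS => n; rewrite /= sub0r normrN E normr_id.
- move=> /cvgrPdist_lt h; apply/has_sumP/cvgrPdist_lt => d /h.
  by apply: filterS => n; rewrite /= sub0r normrN E normr_id.
Qed.

Lemma has_sum_delta (c : nat -> R[i]) j :
  has_sum (fun k => c k * (k == j)%:R) (c j).
Proof.
apply/has_sumP; apply: cvg_near_cst; exists j.+1 => // n /= jn.
rewrite (bigD1_seq j) ?mem_index_iota ?iota_uniq//= eqxx mulr1 big1 ?addr0.
  by rewrite subrr /cabs ComplexField.Normc.normc0.
by move=> i /negbTE ->; rewrite mulr0.
Qed.

End ComplexModulus.

(** Cauchy-Schwarz bounds squared moduli; continuity of the square root at 0 turns such a bound into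
    convergence. *)
Lemma cvg0_le_sqr {R : realType} (v b : nat -> R) :
  (forall n, 0 <= v n) -> (forall n, v n ^+ 2 <= b n) ->
  b n @[n --> \oo] --> (0 : R) -> v n @[n --> \oo] --> (0 : R).
Proof.
move=> v0 vb b0.
apply: (@squeeze_cvgr _ _ _ _ (fun=> 0) (Num.sqrt \o b)); last 2 first.
- exact: cvg_cst.
- by rewrite -[X in _ --> X](@sqrtr0 R); apply: cvg_comp b0 _; exact: sqrt_continuous.
apply: nearW => n; rewrite v0 /= -(ger0_norm (v0 n)) -sqrtr_sqr.
by rewrite ler_sqrt// (le_trans (sqr_ge0 _) (vb n)).
Qed.

(** * Semi-inner products: Cauchy-Schwarz for a form that may vanish on nonzero vectors *)

Section SemiInnerProduct.
Context {R : realType} {V : lmodType R[i]} (B : V -> V -> R[i]).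
Hypothesis BDl : forall a v v' y, B (a *: v + v') y = a * B v y + B v' y.
Hypothesis BJ : forall v y, B y v = (B v y)^*.
Hypothesis B_ge0 : forall v, 0 <= complex.Re (B v v).

Let sqnorm v := complex.Re (B v v).

Lemma form0l y : B 0 y = 0.
Proof.
have := BDl 1 0 0 y; rewrite scaler0 addr0 mul1r.
by rewrite -[X in X = _ -> _]addr0 => /addrI/esym.
Qed.

Lemma formD v v' y : B (v + v') y = B v y + B v' y.
Proof. by have := BDl 1 v v' y; rewrite scale1r mul1r. Qed.

Lemma formZ (a : R[i]) v y : B (a *: v) y = a * B v y.
Proof. by have := BDl a v 0 y; rewrite addr0 form0l addr0. Qed.

Lemma formN v y : B (- v) y = - B v y.
Proof. by rewrite -scaleN1r formZ mulN1r. Qed.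

Lemma formB v v' y : B (v - v') y = B v y - B v' y.
Proof. by rewrite formD formN. Qed.

Lemma form_sum (I : Type) (r : seq I) (P : pred I) (F : I -> V) y :
  B (\sum_(i <- r | P i) F i) y = \sum_(i <- r | P i) B (F i) y.
Proof.
by elim/big_rec2: _ => [|i a b _ <-]; rewrite ?form0l// formD.
Qed.

Lemma formZr (a : R[i]) v y : B v (a *: y) = a^* * B v y.
Proof. by rewrite BJ formZ rmorphM /= -BJ. Qed.

Lemma formBr v y y' : B v (y - y') = B v y - B v y'.
Proof. by rewrite BJ formB rmorphB /= -!BJ. Qed.

Lemma form_sumr (I : Type) (r : seq I) (P : pred I) (F : I -> V) y :
  B y (\sum_(i <- r | P i) F i) = \sum_(i <- r | P i) B y (F i).
Proof.
rewrite BJ form_sum rmorph_sum; apply: eq_bigr => i _; exact/esym/BJ.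
Qed.

(** Hermitian symmetry makes [B v v] its own conjugate, so its imaginary part equals its own
    opposite. *)
Lemma form_selfE v : B v v = (sqnorm v)%:C.
Proof.
have := BJ v v; rewrite /sqnorm; case: (B v v) => a b [] /eqP.
by rewrite -addr_eq0 -mulr2n mulrn_eq0 /= => /eqP ->.
Qed.

Lemma cabs_formC v y : cabs (B v y) = cabs (B y v).
Proof. by rewrite BJ cabsJ. Qed.

Lemma sqnormZ (a : R[i]) v : sqnorm (a *: v) = cabs a ^+ 2 * sqnorm v.
Proof. by rewrite /sqnorm formZ formZr mulrA mulcJ form_selfE -rmorphM. Qed.

Lemma sqnormB v y : sqnorm (v - y) = sqnorm v - 2 * complex.Re (B y v) + sqnorm y.
Proof.
rewrite /sqnorm formB !formBr (BJ y v) !raddfB /=.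
by case: (B y v) => a b /=; ring.
Qed.

(** The parallelogram identity with the nonnegative term [sqnorm (v - y)] dropped; it replaces the
    triangle inequality without square roots. *)
Lemma sqnormD_le v y : sqnorm (v + y) <= 2 * (sqnorm v + sqnorm y).
Proof.
have := B_ge0 (v - y); rewrite -[complex.Re _]/(sqnorm _) sqnormB.
have := sqnormB v (- y); rewrite opprK => ->.
have -> : sqnorm (- y) = sqnorm y.
  by rewrite -scaleN1r sqnormZ -(rmorphN1 (real_complex R)) cabsR normrN1 expr1n mul1r.
by rewrite formN raddfN /=; lra.
Qed.

Lemma form_cauchy_schwarz v y : cabs (B v y) ^+ 2 <= sqnorm v * sqnorm y.
Proof.
(* Expansion of [sqnorm (v - (s%:C * B v y) *: y) >= 0]; the factor [B v y] makes the cross term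
   real. *)
have key (s : R) : s * 2 * cabs (B v y) ^+ 2 <=
    sqnorm v + s ^+ 2 * cabs (B v y) ^+ 2 * sqnorm y.
  have := B_ge0 (v - (s%:C * B v y) *: y).
  rewrite -[complex.Re _]/(sqnorm _) sqnormB sqnormZ formZ (BJ v y).
  rewrite -(mulrA s%:C) mulcJ -rmorphM /= cabsM cabsR exprMn real_normK ?num_real//.
  lra.
have := B_ge0 v; have := B_ge0 y; rewrite -/(sqnorm v) -/(sqnorm y).
rewrite le_eqVlt => /predU1P[y0|y0 v0].
- rewrite -y0 mulr0 in key * => v0.
  rewrite leNgt; apply/negP => c0.
  (* With [sqnorm y] zero, [key] at this [s] reads [2 * (sqnorm v + 1) <= sqnorm v], which is
     absurd. *)
  have := key ((sqnorm v + 1) / cabs (B v y) ^+ 2).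
  rewrite mulr0 addr0 mulrAC divfK ?gt_eqF//; lra.
(* A minimiser of the quadratic in [s]. *)
- have := key (sqnorm y)^-1.
  set c := cabs _ ^+ 2; set a := sqnorm y in y0 *.
  have -> : a^-1 ^+ 2 * c * a = c / a by field; rewrite gt_eqF.
  rewrite -ler_pdivrMr// -/c; set d := c / a.
  rewrite mulrAC (mulrC a^-1) -/d; lra.
Qed.

Lemma form_cvg (v : nat -> V) l y :
  sqnorm (l - v n) @[n --> \oo] --> (0 : R) ->
  (fun n => B (v n) y : R[i]^o) @ \oo --> (B l y : R[i]^o).
Proof.
move=> vl; apply/cvg_cabsP.
apply: (@cvg0_le_sqr _ _ (fun n => sqnorm (l - v n) * sqnorm y)).
- by move=> n; exact: cabs_ge0.
- by move=> n; rewrite -formB; exact: form_cauchy_schwarz.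
- by rewrite -(mul0r (sqnorm y)); exact: cvgMl.
Qed.

(** * Orthonormal sequences: Bessel's inequality, the closed span and Parseval's expansion *)

Section Orthonormal.
Variable e : nat -> V.
Hypothesis e_on : forall i j, B (e i) (e j) = (i == j)%:R.

Lemma form_on_sum (c : nat -> R[i]) m n j : (m <= j < n)%N ->
  B (\sum_(m <= i < n) c i *: e i) (e j) = c j.
Proof.
move=> mjn; rewrite form_sum (bigD1_seq j) ?mem_index_iota ?iota_uniq//=.
rewrite formZ e_on eqxx mulr1 big1 ?addr0// => i ij.
by rewrite formZ e_on (negbTE ij) mulr0.
Qed.

Lemma sqnorm_on_sum (c : nat -> R[i]) m n :
  sqnorm (\sum_(m <= i < n) c i *: e i) = \sum_(m <= i < n) cabs (c i) ^+ 2.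
Proof.
rewrite /sqnorm {2}big_nat form_sumr raddf_sum -big_nat /=.
rewrite [LHS]big_nat [RHS]big_nat; apply: eq_bigr => j mjn.
by rewrite formZr form_on_sum// mulrC mulcJ.
Qed.

Definition proj v n := \sum_(0 <= i < n) B v (e i) *: e i.

(** Pythagoras: the Bessel sum enters with coefficient [-2] through the cross term and [+1] through
    the norm of the projection. *)
Lemma sqnorm_proj v n :
  sqnorm (v - proj v n) = sqnorm v - \sum_(0 <= i < n) cabs (B v (e i)) ^+ 2.
Proof.
rewrite sqnormB /proj sqnorm_on_sum form_sum raddf_sum /=.
have -> : \sum_(0 <= i < n) complex.Re (B (B v (e i) *: e i) v) =
    \sum_(0 <= i < n) cabs (B v (e i)) ^+ 2.
  by apply: eq_bigr => i _; rewrite formZ (BJ v) mulcJ.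
ring.
Qed.

Lemma form_bessel v n : \sum_(0 <= i < n) cabs (B v (e i)) ^+ 2 <= sqnorm v.
Proof. by rewrite -subr_ge0 -sqnorm_proj; exact: B_ge0. Qed.

Lemma sqnorm_proj_le v n : sqnorm (v - proj v n) <= sqnorm v.
Proof. by rewrite sqnorm_proj gerBl sumr_ge0// => i _; exact: sqr_ge0. Qed.

Lemma proj_linear a v v' n : proj (a *: v + v') n = a *: proj v n + proj v' n.
Proof.
rewrite /proj scaler_sumr -big_split /=; apply: eq_bigr => i _.
by rewrite BDl scalerDl scalerA.
Qed.

(** Membership in the closed span of [e], encoded as convergence of the Fourier sums themselves;
    stability under linear combinations and limits is then proved, and Parseval's equality is the
    membership test. *)
Definition spanned v := sqnorm (v - proj v n) @[n --> \oo] --> (0 : R).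

Lemma spannedP v : spanned v <->
  \sum_(0 <= i < n) cabs (B v (e i)) ^+ 2 @[n --> \oo] --> sqnorm v.
Proof.
rewrite /spanned; under eq_fun do rewrite sqnorm_proj.
split=> h.
- rewrite -[X in _ --> X](subr0 (sqnorm v)).
  under eq_fun => n do rewrite -(subKr (sqnorm v) (\sum_(0 <= i < n) _)).
  by apply: cvgB h; exact: cvg_cst.
- rewrite -[X in _ --> X](subrr (sqnorm v)).
  by apply: cvgB h; exact: cvg_cst.
Qed.

Lemma spanned0 : spanned 0.
Proof.
apply/spannedP; rewrite /sqnorm form0l /=.
under eq_fun do under eq_bigr do rewrite form0l cabsR normr0 expr0n.
by under eq_fun do rewrite sumr_const_nat mul0rn; exact: cvg_cst.
Qed.

Lemma spanned_linear a v v' : spanned v -> spanned v' -> spanned (a *: v + v').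
Proof.
move=> hv hv'.
apply: (@squeeze_cvgr _ _ _ _ (fun=> 0) (fun n =>
  2 * (cabs a ^+ 2 * sqnorm (v - proj v n) + sqnorm (v' - proj v' n)))).
- apply: nearW => n; rewrite B_ge0 proj_linear opprD addrACA -scalerBr -sqnormZ.
  exact: sqnormD_le.
- exact: cvg_cst.
- rewrite -[X in _ --> X](mulr0 2); apply: cvgMr.
  rewrite -[X in _ --> X](addr0 0); apply: cvgD => //.
  by rewrite -[X in _ --> X](mulr0 (cabs a ^+ 2)); exact: cvgMr.
Qed.

Lemma spanned_sum (v : nat -> V) (c : nat -> R[i]) n :
  (forall k, spanned (v k)) -> spanned (\sum_(0 <= k < n) c k *: v k).
Proof.
move=> h; elim/big_ind: _ => [|y y' hy hy'|k _]; first exact: spanned0.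
- by rewrite -[y]scale1r; exact: spanned_linear.
- by rewrite -[X in spanned X]addr0; apply: spanned_linear => //; exact: spanned0.
Qed.

(** The residual of [l] splits into that of [l - v N], whose norm is at most that of [l - v N], and
    that of [v N], small for large [n]. *)
Lemma spanned_closed (v : nat -> V) l : (forall n, spanned (v n)) ->
  sqnorm (l - v n) @[n --> \oo] --> (0 : R) -> spanned l.
Proof.
move=> hv vl; apply/cvgrPdist_lt => d d0.
(* [sqnormD_le] doubles the sum of two terms, each below [d / 4]. *)
have d4 : 0 < d / 4 by rewrite divr_gt0.
move/cvgrPdist_lt : (vl) => /(_ _ d4)[N _ /(_ N (leqnn N))] /=.
rewrite sub0r normrN ger0_norm; last exact: B_ge0.
move=> hN; move/cvgrPdist_lt : (hv N) => /(_ _ d4).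
apply: filterS => n /=; rewrite !sub0r !normrN !ger0_norm; try exact: B_ge0.
move=> hn.
have -> : l - proj l n = (l - v N - proj (l - v N) n) + (v N - proj (v N) n).
  rewrite -{1 2}(subrK (v N) l) -{2}[l - v N]scale1r proj_linear scale1r.
  by rewrite opprD addrACA.
have := sqnormD_le (l - v N - proj (l - v N) n) (v N - proj (v N) n).
have := sqnorm_proj_le (l - v N) n.
lra.
Qed.

(** Continuity of [B] in its first argument, applied to the Fourier sums of [v]. *)
Lemma has_sum_spanned v y : spanned v ->
  has_sum (fun n => B v (e n) * B (e n) y) (B v y).
Proof.
move=> hv; rewrite /has_sum.
have -> : series (fun n => B v (e n) * B (e n) y) = (fun n => B (proj v n) y).
  apply/funext => n; rewrite /series /= /proj form_sum.
  by apply: eq_bigr => i _; rewrite formZ.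
exact: form_cvg.
Qed.

Lemma cvgn_bessel v : cvgn (fun n => \sum_(0 <= i < n) cabs (B v (e i)) ^+ 2).
Proof.
apply: nondecreasing_is_cvgn.
- apply/nondecreasing_seqP => n; rewrite big_nat_recr//= lerDl; exact: sqr_ge0.
- by exists (sqnorm v) => _ [n _ <-]; exact: form_bessel.
Qed.

Lemma bessel_le_limn v m : \sum_(0 <= i < m) cabs (B v (e i)) ^+ 2 <=
  limn (fun n => \sum_(0 <= i < n) cabs (B v (e i)) ^+ 2).
Proof.
apply: (nondecreasing_cvgn_le _ (cvgn_bessel v) m).
by apply/nondecreasing_seqP => n; rewrite big_nat_recr//= lerDl; exact: sqr_ge0.
Qed.

Lemma abs_summable_form v y : abs_summable (fun n => B v (e n) * B (e n) y).
Proof.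
apply: nondecreasing_is_cvgn.
- apply/nondecreasing_seqP => n; rewrite /series /= big_nat_recr//= lerDl.
  exact: cabs_ge0.
(* Each term is at most the sum of the squared moduli of the two coefficients, and Bessel's
   inequality bounds both resulting sums. *)
- exists (sqnorm v + sqnorm y) => _ [n _ <-]; rewrite /series /=.
  apply: le_trans (lerD (form_bessel v n) (form_bessel y n)).
  rewrite -big_split /=; apply: ler_sum => i _.
  rewrite cabsM (cabs_formC _ y).
  have := sqr_ge0 (cabs (B v (e i)) - cabs (B y (e i))).
  have := sqr_ge0 (cabs (B v (e i))); have := sqr_ge0 (cabs (B y (e i))).
  rewrite !expr2; lra.
Qed.

(* The bound depends on [v] only through its norm, which makes the convergence
   uniform on bounded families. *)
Lemma form_tail v y n : spanned v ->
  cabs (B v y - \sum_(0 <= i < n) B v (e i) * B (e i) y) ^+ 2 <=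
  sqnorm v * (limn (fun n => \sum_(0 <= i < n) cabs (B y (e i)) ^+ 2)
              - \sum_(0 <= i < n) cabs (B y (e i)) ^+ 2).
Proof.
move=> hv; set S := fun n => \sum_(0 <= i < n) B v (e i) * B (e i) y.
set L := limn _; set T := fun n => \sum_(0 <= i < n) cabs (B y (e i)) ^+ 2.
rewrite -/(S n) -/(T n).
(* [S m - S n] pairs [v] with a block of the Fourier sum of [y], whose squared norm is [T m - T n];
   Cauchy-Schwarz applies. *)
have T_le m : (n <= m)%N -> cabs (S m - S n) ^+ 2 <= sqnorm v * (T m - T n).
  move=> nm.
  have split (U : zmodType) (F : nat -> U) :
      \sum_(0 <= i < m) F i - \sum_(0 <= i < n) F i = \sum_(n <= i < m) F i.
    by rewrite (big_cat_nat (n := n))//= addrAC subrr add0r.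
  rewrite !split.
  rewrite -(sqnorm_on_sum (fun i => B y (e i))).
  apply: le_trans (form_cauchy_schwarz _ _).
  rewrite form_sumr le_eqVlt; apply/orP; left; apply/eqP.
  by congr (cabs _ ^+ 2); apply: eq_bigr => i _; rewrite formZr (BJ y) mulrC.
have S_cvg : S m @[m --> \oo] --> (B v y : R[i]^o) by exact: has_sum_spanned.
have TL m : T m <= L by exact: bessel_le_limn.
(* The limit in [m] is taken up to a slack [d], under square roots so that the triangle inequality
   for the modulus applies. *)
have bnd : cabs (B v y - S n) <= Num.sqrt (sqnorm v * (L - T n)).
  apply/ler_addgt0Pr => d d0.
  move/cvg_cabsP/cvgrPdist_lt : S_cvg => /(_ _ d0)[N _ hN].
  have := hN (maxn N n) (leq_maxl _ _); rewrite /= sub0r normrN ger0_norm ?cabs_ge0//.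
  have := T_le _ (leq_maxr N n); move: (maxn N n) => m hm hd.
  have -> : B v y - S n = (S m - S n) + (B v y - S m) by ring.
  apply: le_trans (ler_cabsD _ _) _; apply: lerD (ltW hd).
  rewrite -(ger0_norm (cabs_ge0 (S m - S n))) -sqrtr_sqr; apply: ler_wsqrtr.
  by apply: le_trans hm _; rewrite ler_wpM2l// ?B_ge0// lerB.
rewrite -[leRHS]sqr_sqrtr ?mulr_ge0 ?B_ge0 ?subr_ge0//.
by rewrite ler_pXn2r// nnegrE ?cabs_ge0 ?sqrtr_ge0.
Qed.

End Orthonormal.

End SemiInnerProduct.

(** * The space L^2(mu) of complex functions with its semi-inner product *)

Section L2Space.
Context {d : measure_display} {T : measurableType d} {R : realType}.
Variable mu : {measure set T -> \bar R}.
Local Notation Re := (@complex.Re R).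
Local Notation Im := (@complex.Im R).

Let sqint (f : T -> R) : \bar R := (\int[mu]_x (f x ^+ 2)%:E)%E.

Let sqint_ge0 f : (0 <= sqint f)%E.
Proof. by apply: integral_ge0 => x _; rewrite lee_fin sqr_ge0. Qed.

Lemma Lnorm2E (f : T -> R) :
  ('N[mu]_(2%:E)[(fun x => (f x)%:E)] = sqint f `^ 2^-1)%E.
Proof.
rewrite unlock; congr (_ `^ _)%E; apply: eq_integral => x _ /=.
by rewrite powR_mulrn// real_normK// num_real.
Qed.

Lemma Lfun2P (f : T -> R) : f \in Lfun mu 2%:E <->
  measurable_fun [set: T] f /\ (sqint f < +oo)%E.
Proof.
rewrite inE; split.
- move=> /andP[/[!inE]/= mf]; rewrite /finite_norm Lnorm2E => h; split => //.
  by apply: (@lty_poweRy _ _ 2^-1).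
- move=> [mf h]; apply/andP; rewrite !inE; split => //=.
  by rewrite /finite_norm Lnorm2E poweR_lty.
Qed.

Lemma L2normE (g : T -> R[i]) : (L2norm mu g = sqint (cabs \o g) `^ 2^-1)%E.
Proof. exact: Lnorm2E. Qed.

(** The integral of the squared modulus is the sum of those of the squared components. This
    transfers closure properties of the real [Lfun] space. *)
Lemma in_L2P (g : T -> R[i]) : in_L2 mu g <->
  Re \o g \in Lfun mu 2%:E /\ Im \o g \in Lfun mu 2%:E.
Proof.
have split_sq : measurable_fun [set: T] (Re \o g) ->
    measurable_fun [set: T] (Im \o g) ->
    sqint (cabs \o g) = (sqint (Re \o g) + sqint (Im \o g))%E.
  move=> mr mi; rewrite /sqint -ge0_integralD//=.
  - by apply: eq_integral => x _; rewrite sqr_cabs EFinD.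
  - by move=> x _; rewrite lee_fin sqr_ge0.
  - by apply/measurable_EFinP; exact: measurable_funX.
  - by move=> x _; rewrite lee_fin sqr_ge0.
  - by apply/measurable_EFinP; exact: measurable_funX.
split.
- move=> [mr mi]; rewrite L2normE => /lty_poweRy h.
  have {h} := h (invr_neq0 (lt0r_neq0 (ltr0Sn R 1))).
  rewrite (split_sq mr mi) => h; split; apply/Lfun2P; split => //; apply: le_lt_trans h.
  + by rewrite leeDl.
  + by rewrite leeDr.
- move=> [/Lfun2P[mr hr] /Lfun2P[mi hi]]; split => //.
  by rewrite L2normE poweR_lty// split_sq// lte_add_pinfty.
Qed.

Let I2 (f h : T -> R) : R := (\int[mu]_x (f x * h x))%R.

Let integrable_mul f h : f \in Lfun mu 2%:E -> h \in Lfun mu 2%:E ->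
  mu.-integrable [set: T] (EFin \o (fun x => f x * h x)).
Proof. by move=> hf hh; apply/Lfun1_integrable; exact: Lfun2_mul_Lfun1. Qed.

Let I2C f h : I2 f h = I2 h f.
Proof. by apply: eq_Rintegral => x _; rewrite mulrC. Qed.

(** Three terms, because each component of [a *: g + g'] mixes both components of [g] with one of
    [g']. *)
Let I2_lin a b f f' f'' h : f \in Lfun mu 2%:E -> f' \in Lfun mu 2%:E ->
  f'' \in Lfun mu 2%:E -> h \in Lfun mu 2%:E ->
  I2 (fun x => a * f x + b * f' x + f'' x) h = a * I2 f h + b * I2 f' h + I2 f'' h.
Proof.
move=> hf hf' hf'' hh; rewrite /I2 -!RintegralZl//; try exact: integrable_mul.
have Zint c k : k \in Lfun mu 2%:E ->
    mu.-integrable [set: T] (EFin \o (fun x => c * (k x * h x))).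
  by move=> hk; exact: (integrableZl measurableT c (integrable_mul _ _ hk hh)).
rewrite -!RintegralD//; try exact: Zint; try exact: integrable_mul.
- by apply: eq_Rintegral => x _; ring.
- exact: (integrableD measurableT (Zint a _ hf) (Zint b _ hf')).
Qed.

Lemma innerE g h : in_L2 mu g -> in_L2 mu h ->
  inner mu g h = (I2 (Re \o g) (Re \o h) + I2 (Im \o g) (Im \o h))
              +i* (I2 (Im \o g) (Re \o h) - I2 (Re \o g) (Im \o h)).
Proof.
move=> /in_L2P[gr gi] /in_L2P[hr hi]; rewrite /inner /cintegral /I2.
rewrite -RintegralD -?RintegralB//; try exact: integrable_mul.
congr (_ +i* _); apply: eq_Rintegral => x _ /=;
  by case: (g x) => a b; case: (h x) => a' b' /=; ring.
Qed.

Let Lfun20 : 0 \in Lfun mu 2%:E.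
Proof. exact: (Lfun_submod_closed mu (lee1n 2)).1. Qed.

Let Lfun2_lin a (f h : T -> R) : f \in Lfun mu 2%:E -> h \in Lfun mu 2%:E ->
  a *: f + h \in Lfun mu 2%:E.
Proof. exact: (Lfun_submod_closed mu (lee1n 2)).2. Qed.

Definition L2pred : {pred T -> R[i]^o} := mem [set g | in_L2 mu g].

Lemma L2predP (g : T -> R[i]^o) : reflect (in_L2 mu g) (g \in L2pred).
Proof. by apply: (iffP idP); rewrite inE. Qed.

Lemma L2pred_submod_closed : submod_closed L2pred.
Proof.
split.
- apply/L2predP/in_L2P; split; exact: Lfun20.
- move=> c g h /L2predP/in_L2P[gr gi] /L2predP/in_L2P[hr hi].
  apply/L2predP/in_L2P; split.
  + have -> : Re \o (c *: g + h) =
        Re c *: (Re \o g) + ((- Im c) *: (Im \o g) + (Re \o h)).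
      apply/funext => x /=; rewrite !fctE /=.
      by case: c (g x) (h x) => c c' [a b] [a' b'] /=; rewrite /GRing.scale /=; ring.
    by do 2!apply: Lfun2_lin => //.
  + have -> : Im \o (c *: g + h) =
        Re c *: (Im \o g) + (Im c *: (Re \o g) + (Im \o h)).
      apply/funext => x /=; rewrite !fctE /=.
      by case: c (g x) (h x) => c c' [a b] [a' b'] /=; rewrite /GRing.scale /=; ring.
    by do 2!apply: Lfun2_lin => //.
Qed.

HB.instance Definition _ :=
  GRing.isSubmodClosed.Build _ _ L2pred L2pred_submod_closed.

(** Functions rather than classes modulo null sets: [L2form] is then only semidefinite, as the
    abstract form [B] allows. The codomain [R[i]^o] provides the module structure over [R[i]]. *)
Definition L2 : Type := {g : T -> R[i]^o | g \in L2pred}.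

HB.instance Definition _ := SubType.on L2.
HB.instance Definition _ := [Choice of L2 by <:].
HB.instance Definition _ := [SubChoice_isSubLmodule of L2 by <:].

Definition mkL2 (g : T -> R[i]) (hg : in_L2 mu g) : L2 :=
  exist _ (g : T -> R[i]^o) (introT (L2predP g) hg).

Lemma L2_in (g : L2) : in_L2 mu (val g).
Proof. exact/L2predP/valP. Qed.

Definition L2form (g h : L2) : R[i] := inner mu (val g) (val h).

Lemma L2formDl a g g' h : L2form (a *: g + g') h = a * L2form g h + L2form g' h.
Proof.
rewrite /L2form !innerE; try exact: L2_in.
have /in_L2P[gr gi] := L2_in g; have /in_L2P[gr' gi'] := L2_in g'.
have /in_L2P[hr hi] := L2_in h.
have -> : Re \o val (a *: g + g') = (fun x => Re a * (Re \o val g) x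
    + (- Im a) * (Im \o val g) x + (Re \o val g') x).
  apply/funext => x; rewrite linearP /= !fctE /=.
  by case: a (val g x) (val g' x) => c c' [b b'] [y y'] /=; rewrite /GRing.scale /=; ring.
have -> : Im \o val (a *: g + g') = (fun x => Re a * (Im \o val g) x
    + Im a * (Re \o val g) x + (Im \o val g') x).
  apply/funext => x; rewrite linearP /= !fctE /=.
  by case: a (val g x) (val g' x) => c c' [b b'] [y y'] /=; rewrite /GRing.scale /=; ring.
rewrite !I2_lin//; case: a => c c' /=.
by apply/eqP; rewrite eq_complex /=; apply/andP; split; apply/eqP; ring.
Qed.

Lemma L2formJ g h : L2form h g = (L2form g h)^*.
Proof.
rewrite /L2form !innerE; try exact: L2_in.
by rewrite (I2C (Re \o val h)) (I2C (Im \o val h)) (I2C (Im \o val h))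
  (I2C (Re \o val h)) /= opprB.
Qed.

Lemma L2form_selfE (g : L2) : L2form g g = (fine (sqint (cabs \o val g)))%:C.
Proof.
rewrite /L2form /inner /cintegral /Rintegral /sqint.
under eq_integral do rewrite mulcJ.
under [X in _ +i* fine X]eq_integral do rewrite mulcJ.
by rewrite integral0.
Qed.

Lemma L2form_ge0 (g : L2) : 0 <= Re (L2form g g).
Proof. by rewrite L2form_selfE /= fine_ge0. Qed.

Lemma L2norm_form (g : L2) : L2norm mu (val g) = (Num.sqrt (Re (L2form g g)))%:E.
Proof.
rewrite L2form_selfE L2normE /=.
have [_ _] := L2_in g; rewrite L2normE => /lty_poweRy.
move=> /(_ (invr_neq0 (lt0r_neq0 (ltr0Sn R 1)))) h.
rewrite -{1}(@fineK _ (sqint _)); last by rewrite ge0_fin_numE.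
by rewrite poweR_EFin powR12_sqrt// fine_ge0.
Qed.

Lemma in_L2_conj (g : T -> R[i]) : in_L2 mu g -> in_L2 mu (fun x => (g x)^*).
Proof.
move=> /in_L2P[gr gi]; apply/in_L2P; split.
- by have -> : Re \o (fun x => (g x)^*) = Re \o g
    by apply/funext => x /=; case: (g x).
- have -> : Im \o (fun x => (g x)^*) = (-1) *: (Im \o g) + 0.
    apply/funext => x /=; rewrite !fctE /= addr0; case: (g x) => a b /=.
    by rewrite /GRing.scale /= mulN1r.
  exact: Lfun2_lin.
Qed.

Lemma inner_ae_eq (g h h' : T -> R[i]) : in_L2 mu g -> in_L2 mu h ->
  in_L2 mu h' -> {ae mu, forall x, h x = h' x} -> inner mu g h = inner mu g h'.
Proof.
move=> gL hL hL' hh'; rewrite !innerE// /I2.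
move: gL hL hL' => [gr gi _] [hr hi _] [hr' hi' _].
by congr (_ +i* _); congr (_ + _); rewrite ?opprK; try congr (- _);
  congr fine; apply: ae_eq_integral => //;
  first [by apply/measurable_EFinP; exact: measurable_funM
        |by apply: filterS hh' => x /= -> ].
Qed.

(** The norm of the remainder is the square root of [q]; squaring gives convergence in the seminorm
    of [L2form]. *)
Lemma has_L2_sum_cvg (g : nat -> L2) (h : L2) :
  has_L2_sum mu (fun n => val (g n)) (val h) ->
  Re (L2form (h - \sum_(0 <= k < n) g k) (h - \sum_(0 <= k < n) g k))
    @[n --> \oo] --> (0 : R).
Proof.
set q := fun n => Re (L2form (h - \sum_(0 <= k < n) g k) _).
rewrite /has_L2_sum.
have -> : (fun N => L2norm mu (fun x => val h x - \sum_(0 <= k < N) val (g k) x)) =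
    (fun N => (Num.sqrt (q N))%:E).
  apply/funext => N; rewrite -L2norm_form; congr L2norm; apply/funext => x.
  have -> : val (h - \sum_(0 <= k < N) g k) =
      val h - \sum_(0 <= k < N) (val (g k) : T -> R[i]^o).
    by rewrite (raddfB (val : L2 -> _)) (raddf_sum (val : L2 -> _)).
  by rewrite !fctE fct_sumE.
move/fine_cvgP => [_ /=] h0.
have -> : q = (fun n => Num.sqrt (q n) * Num.sqrt (q n)).
  by apply/funext => n; rewrite -expr2 sqr_sqrtr// L2form_ge0.
by rewrite -[X in _ --> X](mulr0 0); exact: cvgM.
Qed.

End L2Space.

(** * Sampling: normalised kernel sections as an orthonormal sequence *)

Theorem theorem3 (R : realType)
  (mu : {measure set (measurableTypeR R) -> \bar R})
  (p : nat -> R -> R[i])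
  (p_orthonormal : orthonormal_system mu p)
  (p_complete : complete_system mu p)
  (t : nat -> R) (rho : R -> R) (r : nat -> R -> R[i])
  (rho_gt0 : forall j, 0 < rho (t j))
  (r_orthonormal : discrete_orthonormal t rho r)
  (r_dual : dual_orthogonal t rho r)
  (r_complete : discrete_complete t rho r)
  (w : nat -> R[i])
  (w_unit : forall k, cabs (w k) = 1)
  (x : nat -> R)
  (x_neq0 : forall n, x n != 0)
  (t_x : forall n, t n = 1 / x n)
  (J : nat -> R -> R[i])
  (J_l2 : forall s, square_summable (fun k => J k s))
  (lam : nat -> R)
  (lam_neq0 : forall n, lam n != 0)
  (J_interp : forall k n, J k (x n) = (lam n)%:C * r k (1 / x n))
  (K : R -> R -> R[i])
  (K_L2 : forall s, in_L2 mu (K^~ s))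
  (K_sum : forall s, has_L2_sum mu (fun k y => J k s * p k y * w k) (K^~ s))
  (u : R -> R[i])
  (u_L2 : in_L2 mu u)
  (f : R -> R[i])
  (f_def : forall s, f s = cintegral mu (fun y => u y * K y s)) :
  let k := repr_kernel mu K in
  let sample n s := f (x n) * (k s (x n) / k (x n) (x n)) in
  [/\ exists a : nat -> R[i],
        [/\ forall n, a n = w n * inner mu u (fun y => (p n y)^*),
            forall n, {ae mu, forall y, complex.Im (p n y) = 0} ->
              a n = w n * inner mu u (p n) &
            forall s, has_sum (fun n => a n * J n s) (f s)],
      forall s, has_sum (fun n => sample n s) (f s),
      forall s, abs_summable (fun n => sample n s) &
      forall E : set R,
        (exists M : R, forall s, E s -> (L2norm mu (K^~ s) <= M%:E)%E) ->
        {uniform E,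
          (fun N s => (\sum_(0 <= n < N) sample n s : R[i]^o)) @ \oo -->
          (f : R -> R[i]^o)}].
Proof.
move=> k sample.
set B := L2form mu.
have BDl := L2formDl mu : forall a v v' y, B (a *: v + v') y = a * B v y + B v' y.
have BJ := L2formJ mu : forall v y, B y v = (B v y)^*.
have B0 := L2form_ge0 mu : forall v, 0 <= complex.Re (B v v).
pose P i : L2 mu := mkL2 mu _ (p_orthonormal.1 i).
pose U : L2 mu := mkL2 mu _ (in_L2_conj mu _ u_L2).
pose Q s : L2 mu := mkL2 mu _ (K_L2 s).
(* The integral defining [f] has no conjugate while [inner] conjugates its second argument; taking
   the conjugate of [u] for [U] reconciles them. *)
have uB (g : L2 mu) : cintegral mu (fun y => u y * val g y) = B g U.
  rewrite /B /L2form /inner; congr cintegral.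
  by apply/funext => y; rewrite mulrC -{1}[u y]conjcK.
have fE s : f s = B (Q s) U by rewrite f_def -uB.
have PP i j : B (P i) (P j) = (i == j)%:R by exact: p_orthonormal.2.
have Q_cvg s : complex.Re (B (Q s - \sum_(0 <= i < n) (J i s * w i) *: P i)
    (Q s - \sum_(0 <= i < n) (J i s * w i) *: P i)) @[n --> \oo] --> (0 : R).
  apply: (has_L2_sum_cvg mu (fun i => (J i s * w i) *: P i)).
  have -> : (fun i => val ((J i s * w i) *: P i)) =
      (fun i y => J i s * p i y * w i).
    by apply/funext => i; apply/funext => y; rewrite mulrAC.
  exact: K_sum.
have QB s y : has_sum (fun i => J i s * w i * B (P i) y) (B (Q s) y).
  rewrite /has_sum.
  have -> : series (fun i => J i s * w i * B (P i) y) =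
      (fun n => B (\sum_(0 <= i < n) (J i s * w i) *: P i) y).
    apply/funext => n; rewrite (form_sum _ BDl); apply: eq_bigr => i _.
    by rewrite (formZ _ BDl).
  exact: (form_cvg _ BDl BJ B0 _ _ _ (Q_cvg s)).
(* Uniqueness of sums: by orthonormality only the term [j] of the expansion survives. *)
have QP s j : B (Q s) (P j) = J j s * w j.
  apply: has_sum_unique (QB _ _) _.
  under eq_fun do rewrite PP.
  exact: (has_sum_delta (fun i => J i s * w i)).
have ww i : w i * (w i)^* = 1 by rewrite mulcJ w_unit expr1n.
have QQ s s' : has_sum (fun i => J i s * (J i s')^*) (B (Q s) (Q s')).
  have := QB s (Q s'); congr has_sum; apply/funext => i.
  by rewrite (BJ _ (P i)) QP rmorphM /= mulrACA ww mulr1.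
(* The unimodular [w i] cancel in [QQ], and interpolation turns the series into the dual
   orthogonality relation of the [r i]. *)
have Qx n m : B (Q (x n)) (Q (x m)) =
    (lam n)%:C * (lam m)%:C * ((m == n)%:R / (rho (t n))%:C).
  apply: has_sum_unique (QQ _ _) _.
  have := has_sumZ ((lam n)%:C * (lam m)%:C) _ _ (r_dual m n).
  congr has_sum; apply/funext => i /=.
  have Jm : (J i (x m))^* = (lam m)%:C * (r i (t m))^*.
    by rewrite J_interp -t_x rmorphM; congr (_ * _); exact: conjc_real.
  by rewrite J_interp -t_x mulrACA; congr (_ * _); exact/esym/Jm.
(* The value [k (x n) (x n)]. *)
pose kn n := lam n ^+ 2 / rho (t n).
have kn0 n : 0 < kn n by apply: divr_gt0; rewrite ?exprn_even_gt0 ?lam_neq0 ?rho_gt0.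
have knE n : B (Q (x n)) (Q (x n)) = (kn n)%:C.
  by rewrite Qx eqxx /kn mul1r !rmorphM /= fmorphV.
pose sk n := Num.sqrt (kn n).
have sk0 n : 0 < sk n by rewrite sqrtr_gt0.
have skE n : sk n * sk n = kn n by rewrite -expr2 sqr_sqrtr// ltW.
pose e n : L2 mu := ((sk n)^-1)%:C *: Q (x n).
have e_on i j : B (e i) (e j) = (i == j)%:R.
  rewrite /e (formZ _ BDl) (formZr _ BDl BJ) conjcR.
  have [<-|ij] := eqVneq i j; last by rewrite Qx eq_sym (negbTE ij) mul0r !mulr0.
  by rewrite knE -!rmorphM -skE mulrA -invfM mulVf// mulf_neq0// gt_eqF.
(* The squared coefficient of [P i] along [e n] is [rho (t n)] times the squared modulus of
   [r i (t n)]; discrete orthonormality sums these to 1, the squared norm of [P i]. *)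
have P_spanned i : spanned B e (P i).
  apply/(spannedP _ BDl BJ _ e_on); rewrite PP eqxx -[complex.Re _]/(1 : R).
  apply/has_sum_real; have := r_orthonormal i i; rewrite eqxx.
  congr has_sum; apply/funext => n.
  rewrite -mulrA mulcJ -rmorphM; congr (_%:C).
  rewrite /e (cabs_formC _ BJ) (formZ _ BDl) QP J_interp -t_x !cabsM w_unit.
  rewrite mulr1 !cabsR !exprMn !real_normK ?num_real// exprVn (skE n : sk n ^+ 2 = _) /kn.
  by field; rewrite lam_neq0 gt_eqF// rho_gt0.
have Q_spanned s : spanned B e (Q s).
  apply: (spanned_closed _ BDl BJ B0 _ e_on _ _ _ (Q_cvg s)) => n.
  exact: (spanned_sum _ BDl BJ B0 _ e_on).
(* The weight [1 / kn n] is shared out as one factor [1 / sk n] for each of the two coefficients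
   along [e n]. *)
have sampleE n s : sample n s = B (Q s) (e n) * B (e n) U.
  rewrite /sample /e (formZ _ BDl) (formZr _ BDl BJ) conjcR fE.
  rewrite -[k s (x n)]/(B (Q s) (Q (x n))) -[k (x n) (x n)]/(B (Q (x n)) (Q (x n))).
  rewrite knE -skE rmorphM fmorphV /= invfM.
  by ring.
split.
(* Termwise integration yields the integral of [u * p n], which is the inner product with the
   conjugate of [p n]; for [p n] real almost everywhere this is [inner mu u (p n)]. *)
- exists (fun n => w n * inner mu u (fun y => (p n y)^*)); split => //.
  + move=> n pn; congr (_ * _); apply: inner_ae_eq => //.
    * exact: in_L2_conj (p_orthonormal.1 n).
    * exact: p_orthonormal.1 n.
    * apply: (@filterS _ _ (ae_filter_ringOfSetsType mu) _ _ _ pn) => y.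
      by case: (p n y) => a b /= ->; rewrite oppr0.
  + move=> s; rewrite fE; have := QB s U; congr has_sum; apply/funext => n.
    have -> : inner mu u (fun y => (p n y)^*) = B (P n) U.
      rewrite -uB; congr cintegral; apply/funext => y.
      exact/(congr1 (GRing.mul _))/conjcK.
    by ring.
- move=> s; rewrite fE (_ : (fun n => _) = fun n => B (Q s) (e n) * B (e n) U).
    exact: (has_sum_spanned _ BDl BJ B0).
  by apply/funext => n; exact: sampleE.
- move=> s; rewrite (_ : (fun n => _) = fun n => B (Q s) (e n) * B (e n) U).
    exact: (abs_summable_form _ BDl BJ B0).
  by apply/funext => n; exact: sampleE.
- move=> E [M hM] A /uniform_nbhs[D [entD DA]].
  move: entD; rewrite -entourage_ballE => -[[d d'] /=].
  rewrite ltcE /= => /andP[/eqP -> d0] dD.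
  set L := limn (fun n => \sum_(0 <= i < n) cabs (B U (e i)) ^+ 2).
  (* The bound of [form_tail] with the squared norm of [Q s] replaced by [M ^+ 2], hence free of
     [s]; it is compared with [d ^+ 2] because it controls a squared modulus. *)
  pose tail n := M ^+ 2 * (L - \sum_(0 <= i < n) cabs (B U (e i)) ^+ 2).
  have tail0 : tail n @[n --> \oo] --> (0 : R).
    rewrite -[X in _ --> X](mulr0 (M ^+ 2)) -(subrr L); apply: cvgMr.
    by apply: cvgB; [exact: cvg_cst|exact: (cvgn_bessel _ BDl BJ B0 _ e_on)].
  move/cvgrPdist_lt : tail0 => /(_ _ (exprn_gt0 2 d0)).
  apply: filterS => n /=; rewrite sub0r normrN => tn.
  apply: DA => s Es; apply: dD => /=; rewrite /ball /=.
  rewrite [X in X < _]cabsE ltcR -(ltr_pXn2r (n:=2)) ?nnegrE ?cabs_ge0 ?(ltW d0)//.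
  apply: le_lt_trans tn; apply: le_trans (ler_norm _).
  rewrite fE (eq_bigr _ (fun i _ => sampleE i s)).
  apply: le_trans (form_tail _ BDl BJ B0 _ e_on _ _ _ (Q_spanned s)) _.
  rewrite ler_wpM2r//.
  + by rewrite subr_ge0; exact: (bessel_le_limn _ BDl BJ B0 _ e_on).
  (* [M] is nonnegative because it dominates a norm at the point [s] of [E]. *)
  + have := hM _ Es; rewrite (L2norm_form mu (Q s)) lee_fin => hs.
    rewrite -[leLHS]sqr_sqrtr ?B0// ler_pXn2r// nnegrE ?sqrtr_ge0//.
    exact: le_trans (sqrtr_ge0 _) hs.
Qed.
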